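(* Let $ABC$ be a nondegenerate triangle in the Euclidean plane, let $O$ be its circumcenter, and assume that $O$ lies inside $\triangle ABC$. Let lines $AO$, $BO$, $CO$ meet the sides $BC$, $CA$, $AB$ at $D$, $E$, $F$, respectively, so that the cevians $AD$, $BE$, $CF$ divide $\triangle ABC$ into the six triangles $T_1=OBD$, $T_2=ODC$, $T_3=OCE$, $T_4=OEA$, $T_5=OAF$, $T_6=OFB$. Let $R_i$ be the circumradius of $T_i$ for $i=1,\dots,6$. Then $R_1=R_2$, $R_3=R_4$, and $R_5=R_6$.
   Context: A cevian through a point is a segment from a vertex of the triangle through that point to the opposite side. *)

(* Defs.v *)
From HB Require Import structures.
From mathcomp Require Import all_boot all_order all_algebra.
From mathcomp Require Import reals.

Set Implicit Arguments.
Unset Strict Implicit.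
Unset Printing Implicit Defensive.

Import Order.TTheory GRing.Theory Num.Theory.

Local Open Scope ring_scope.

Notation "''plane_' R" := 'rV[R]_2
  (at level 8, R at level 2, format "''plane_' R") : type_scope.

Section EuclideanPlane.
Variable R : realType.
Implicit Types A B C O P Q X : 'plane_R.

(* The Euclidean distance; the norm that MathComp-Analysis puts on row vectors
   is the sup norm. *)
Definition dist P Q : R := Num.sqrt (\sum_(i < 2) (P 0 i - Q 0 i) ^+ 2).

(* This is a line only when P <> Q. *)
Definition line P Q X : Prop := exists t : R, X = P + t *: (Q - P).

Definition segment P Q X : Prop :=
  exists t : R, 0 <= t <= 1 /\ X = P + t *: (Q - P).

Definition collinear A B C : Prop :=
  exists P Q, [/\ P <> Q, line P Q A, line P Q B & line P Q C].

Definition nondegenerate_triangle A B C : Prop := ~ collinear A B C.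

(* The open triangle: the sides are excluded. *)
Definition inside_triangle A B C X : Prop :=
  exists a b c : R,
    [/\ 0 < a, 0 < b, 0 < c, a + b + c = 1
      & X = a *: A + b *: B + c *: C].

Definition is_circumcircle A B C O (r : R) : Prop :=
  [/\ dist O A = r, dist O B = r & dist O C = r].

Definition is_circumcenter A B C O : Prop := exists r, is_circumcircle A B C O r.

(* A nondegenerate triangle has exactly one circumradius in this sense. *)
Definition is_circumradius A B C (r : R) : Prop :=
  exists O, is_circumcircle A B C O r.

End EuclideanPlane.

(* Main.v *)
(* Reflection in the midpoint of OD carries the circle OBD to the circle ODC:
   since OB = OC and D lies on BC, if P is the circumcenter of OBD then O + D - P
   is equidistant from O, D and C.  Circumcenters being unique, the two triangles
   on each side have equal circumradii. *)
Require Import Defs.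
From HB Require Import structures.
From mathcomp Require Import all_boot all_order all_algebra.
From mathcomp Require Import reals.
From mathcomp Require Import ring lra.

Set Implicit Arguments.
Unset Strict Implicit.
Unset Printing Implicit Defensive.

Import Order.TTheory GRing.Theory Num.Theory.

Local Open Scope ring_scope.

Section Circumradii.
Variable R : realType.
Implicit Types A B C D O P Q X : 'plane_R.

(** Polynomial in the coordinates, so that [ring] and [lra] apply to equidistance conditions. *)
Definition sqdist P Q : R := (P 0 0 - Q 0 0) ^+ 2 + (P 0 1 - Q 0 1) ^+ 2.

(** Twice the signed area of the triangle. *)
Definition cross A B C : R :=
  (B 0 0 - A 0 0) * (C 0 1 - A 0 1) - (B 0 1 - A 0 1) * (C 0 0 - A 0 0).

Lemma distE P Q : dist P Q = Num.sqrt (sqdist P Q).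
Proof.
rewrite /dist /sqdist big_ord_recl big_ord1.
by rewrite (_ : lift ord0 ord0 = 1) //; apply/val_inj.
Qed.

Lemma sqdist_ge0 P Q : 0 <= sqdist P Q.
Proof. by rewrite addr_ge0 ?sqr_ge0. Qed.

Lemma dist_inj P Q P' Q' : dist P Q = dist P' Q' -> sqdist P Q = sqdist P' Q'.
Proof.
by rewrite !distE => /eqP; rewrite eqr_sqrt ?sqdist_ge0 // => /eqP.
Qed.

Lemma plane_eq P Q : P 0 0 = Q 0 0 -> P 0 1 = Q 0 1 -> P = Q.
Proof.
move=> e0 e1; apply/rowP; case=> [[|[|k]]] // lt_k2.
- by rewrite (_ : Ordinal lt_k2 = 0) //; apply/val_inj.
- by rewrite (_ : Ordinal lt_k2 = 1) //; apply/val_inj.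
Qed.

Lemma cross_line P Q X : P <> Q -> cross P Q X = 0 -> line P Q X.
Proof.
move=> neqPQ /eqP; rewrite /cross subr_eq0 => /eqP cross0.
(* A vertical line is parametrized by its second coordinate, any other line by its first. *)
have [n0|n0] := eqVneq (Q 0 0 - P 0 0) 0.
  have n1 : Q 0 1 - P 0 1 != 0.
    apply: contra_notN neqPQ => /eqP n1.
    by apply: plane_eq; apply/esym/subr0_eq.
  exists ((X 0 1 - P 0 1) / (Q 0 1 - P 0 1)).
  apply: plane_eq; rewrite !mxE; last by field.
  rewrite n0 mulr0 addr0; apply: subr0_eq; apply: (mulfI n1).
  by rewrite -cross0 n0 mul0r mulr0.
exists ((X 0 0 - P 0 0) / (Q 0 0 - P 0 0)).
apply: plane_eq; rewrite !mxE; first by field.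
transitivity (P 0 1 + (Q 0 0 - P 0 0) * (X 0 1 - P 0 1) / (Q 0 0 - P 0 0)).
  by field.
by rewrite cross0; field.
Qed.

Lemma line_cross P Q X : line P Q X -> cross P Q X = 0.
Proof. by move=> [t ->]; rewrite /cross !mxE; ring. Qed.

Lemma line_source P Q : line P Q P.
Proof. by exists 0; rewrite scale0r addr0. Qed.

Lemma line_target P Q : line P Q Q.
Proof. by exists 1; rewrite scale1r addrC subrK. Qed.

Lemma nondegenerate_cross A B C :
  nondegenerate_triangle A B C -> cross A B C != 0.
Proof.
move=> nd; apply/eqP => cross0; apply: nd.
have [eqAB|/eqP neqAB] := eqVneq A B; last first.
  exists A, B; split; [by []|exact: line_source|exact: line_target|].
  exact: cross_line.
have [eqAC|/eqP neqAC] := eqVneq A C; last first.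
  exists A, C; rewrite -eqAB.
  by split; [|exact: line_source|exact: line_source|exact: line_target].
(* All three vertices coincide here, so any second point gives a line through them. *)
exists A, (A + const_mx 1); rewrite -eqAB -eqAC; split; try exact: line_source.
move=> /rowP/(_ 0); rewrite !mxE => /eqP.
by rewrite -subr_eq0 opprD addrA subrr sub0r oppr_eq0 oner_eq0.
Qed.

Lemma cross_rot A B C : cross B C A = cross A B C.
Proof. by rewrite /cross; ring. Qed.

Lemma cramer2 (a b c d x y : R) : a * d - b * c != 0 ->
  a * x + b * y = 0 -> c * x + d * y = 0 -> x = 0 /\ y = 0.
Proof.
move=> n0 e1 e2; split; apply: (mulfI n0).
  transitivity (d * (a * x + b * y) - b * (c * x + d * y)); first by ring.
  by rewrite e1 e2; ring.
transitivity (a * (c * x + d * y) - c * (a * x + b * y)); first by ring.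
by rewrite e1 e2; ring.
Qed.

(** Subtracting the conditions on [Q] from those on [P] cancels the quadratic terms: [P - Q] is
    orthogonal to [B - A] and [C - A], a linear system with determinant [cross A B C]. *)
Lemma circumcenter_unique A B C P Q :
    cross A B C != 0 ->
    sqdist P A = sqdist P B -> sqdist P A = sqdist P C ->
    sqdist Q A = sqdist Q B -> sqdist Q A = sqdist Q C ->
  P = Q.
Proof.
rewrite /cross /sqdist => n0 PB PC QB QC.
have [] := @cramer2 _ _ _ _ (P 0 0 - Q 0 0) (P 0 1 - Q 0 1) n0.
- lra.
- lra.
by move=> e0 e1; apply: plane_eq; apply: subr0_eq.
Qed.

Lemma reflected_circumcenter O B C P (s : R) (D := B + s *: (C - B)) :
    s != 0 -> sqdist O B = sqdist O C ->
    sqdist P O = sqdist P B -> sqdist P O = sqdist P D ->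
  sqdist (O + D - P) O = sqdist (O + D - P) C.
Proof.
(* Multiplied by [s], the difference of the two sides is a linear combination of the three
   differences that vanish by hypothesis. *)
move=> s0 OBC PB PD; apply/subr0_eq/(mulfI s0); rewrite mulr0.
transitivity (s * (1 - s) * (sqdist O B - sqdist O C)
  - (sqdist P O - sqdist P D) + (1 - s) * (sqdist P O - sqdist P B)).
  by rewrite /sqdist /D !mxE; ring.
by rewrite -OBC -PB -PD !subrr !mulr0 subr0 addr0.
Qed.

Lemma circumradius_eq O B C (s : R) (D := B + s *: (C - B)) (r r' : R) :
    cross O B C != 0 -> s != 0 -> s != 1 -> dist O B = dist O C ->
    is_circumradius O B D r -> is_circumradius O D C r' ->
  r = r'.
Proof.
move=> n0 s0 s1 /dist_inj OBC [P [PO PB PD]] [Q [QO QD QC]].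
have sqPB : sqdist P O = sqdist P B by apply: dist_inj; rewrite PO PB.
have sqPD : sqdist P O = sqdist P D by apply: dist_inj; rewrite PO PD.
have sqQD : sqdist Q O = sqdist Q D by apply: dist_inj; rewrite QO QD.
have sqQC : sqdist Q O = sqdist Q C by apply: dist_inj; rewrite QO QC.
(* As [C - D] is [1 - s] times [C - B], the area scales by that factor; [s != 1] keeps [O D C]
   nondegenerate. *)
have crossODC : cross O D C != 0.
  have -> : cross O D C = (1 - s) * cross O B C.
    by rewrite /cross /D !mxE; ring.
  by rewrite mulf_neq0 // subr_eq0 eq_sym.
(* The reflection swaps [O] and [D]. *)
have reflPD : sqdist (O + D - P) O = sqdist (O + D - P) D.
  by move: sqPD; rewrite /sqdist !mxE; lra.
have reflPC : sqdist (O + D - P) O = sqdist (O + D - P) C.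
  exact: reflected_circumcenter.
have eqQ := circumcenter_unique crossODC sqQD sqQC reflPD reflPC.
rewrite -PD -QO !distE eqQ; congr Num.sqrt.
by rewrite /sqdist !mxE; ring.
Qed.

Lemma inside_triangle_rot A B C O :
  inside_triangle A B C O -> inside_triangle B C A O.
Proof.
move=> [a [b [c [a0 b0 c0 abc ->]]]]; exists b, c, a.
by split=> //; [rewrite -abc addrC addrA|rewrite [RHS]addrC addrA].
Qed.

(** Up to sign, the barycentric coordinates of [O] are the ratios of the areas of [O B C], [A O C],
    [A O B] to that of [A B C]. Being positive, they make [O B C] nondegenerate and keep [B] and [C]
    off the line [A O], so [D] is neither of them. *)
Lemma cevian_circumradius_eq A B C O D (r r' : R) :
    cross A B C != 0 -> inside_triangle A B C O -> dist O B = dist O C ->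
    line A O D -> segment B C D ->
    is_circumradius O B D r -> is_circumradius O D C r' ->
  r = r'.
Proof.
move=> n0 [a [b [c [a0 b0 c0 abc defO]]]] OBC /line_cross AOD [s [_ defD]].
(* Eliminating [a] turns the area ratios into polynomial identities. *)
have aE : a = 1 - b - c by rewrite -abc; ring.
have crossOBC : cross O B C = a * cross A B C.
  by rewrite defO aE /cross !mxE; ring.
have crossAOB : cross A O B = - (c * cross A B C).
  by rewrite defO aE /cross !mxE; ring.
have crossAOC : cross A O C = b * cross A B C.
  by rewrite defO aE /cross !mxE; ring.
rewrite defD; apply: circumradius_eq OBC.
- by rewrite crossOBC mulf_neq0 // gt_eqF.
- apply/eqP => s0; move/eqP: AOD.
  by rewrite defD s0 scale0r addr0 crossAOB oppr_eq0 mulf_eq0 gt_eqF // (negPf n0).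
- apply/eqP => s1; move/eqP: AOD.
  by rewrite defD s1 scale1r addrC subrK crossAOC mulf_eq0 gt_eqF // (negPf n0).
Qed.

End Circumradii.

Theorem theorem2p3 (R : realType) (A B C O D E F : 'plane_R)
    (R1 R2 R3 R4 R5 R6 : R)
    (ndABC : nondegenerate_triangle A B C)
    (centerO : is_circumcenter A B C O)
    (insideO : inside_triangle A B C O)
    (AO_BC_D : line A O D /\ segment B C D)
    (BO_CA_E : line B O E /\ segment C A E)
    (CO_AB_F : line C O F /\ segment A B F)
    (radius1 : is_circumradius O B D R1)
    (radius2 : is_circumradius O D C R2)
    (radius3 : is_circumradius O C E R3)
    (radius4 : is_circumradius O E A R4)
    (radius5 : is_circumradius O A F R5)
    (radius6 : is_circumradius O F B R6) :
  [/\ R1 = R2, R3 = R4 & R5 = R6].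
Proof.
have n0 := nondegenerate_cross ndABC.
have [r [OA OB OC]] := centerO.
(* The cevians from [B] and [C] follow by cyclic relabelling of the vertices. *)
have insideBCA := inside_triangle_rot insideO.
have insideCAB := inside_triangle_rot insideBCA.
have [[AOD BCD] [BOE CAE] [COF ABF]] := And3 AO_BC_D BO_CA_E CO_AB_F.
split.
- by apply: cevian_circumradius_eq AOD BCD radius1 radius2; rewrite ?OB ?OC.
- apply: cevian_circumradius_eq BOE CAE radius3 radius4; rewrite ?OC ?OA //.
  by rewrite cross_rot.
- apply: cevian_circumradius_eq COF ABF radius5 radius6; rewrite ?OA ?OB //.
  by rewrite 2!cross_rot.
Qed.
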